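(* Let $n$ and $t$ be integers such that $n\ge1$ and $0\le t\le n-1$. Then $$|\mathcal{IS}_{n,t}(102)|=|\mathcal{UVD}_{n,t}|=\sum_{j=t+1}^{n}(-1)^{n-j}\,\frac{t+1}{j}\binom{3j-t-2}{j-t-1}\binom{j}{n-j}.$$
   Context: An inversion sequence of length $n$ is an integer sequence $e=(e_1,\dots,e_n)$ with $0\le e_j\le j-1$ for all $j$. It avoids $102$ if there are no $i<j<k$ with $e_j<e_i<e_k$. $\max(e)$ is the largest entry, and $\mathrm{fdes}(e)$ is the position $p$ of the first descent: $e_1\le\cdots\le e_p>e_{p+1}$, with the convention $e_{n+1}=-1$. For a $102$-avoiding $e$, $\mathrm{rank}(e):=\mathrm{fdes}(e)-\max(e)-1$. $\mathcal{IS}_{n,t}(102)$ is the set of $102$-avoiding inversion sequences $e$ of length $n$ with $\mathrm{rank}(e)=t$. A UVD path of semilength $n$ is a lattice path from $(0,0)$ to $(2n,0)$ staying weakly above the $x$-axis, with steps $u=(1,1)$, $d=(1,-1)$, $v=(0,-2)$, with no consecutive $uv$ or $vu$, ending with a $d$ step. $\mathrm{vox}(S)$ is the number of valleys $du$ of $S$ on the $x$-axis. $\mathcal{UVD}_{n,t}$ is the set of UVD paths $S$ of semilength $n$ with $\mathrm{vox}(S)=t$. *)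

(* Defs.v *)
From HB Require Import structures.
From mathcomp Require Import all_boot all_order all_algebra.
From mathcomp Require Import zify.

Set Implicit Arguments.
Unset Strict Implicit.
Unset Printing Implicit Defensive.

Import Order.TTheory GRing.Theory Num.Theory.

(* Sequences are 0-indexed: the mathematical e_j is [e i] with i = j - 1, so
   the bound e_j <= j - 1 reads [e i <= i].  Since e_j <= j - 1 < n, taking
   entries in 'I_n loses nothing. *)
Definition is_invseq n (e : {ffun 'I_n -> 'I_n}) : bool :=
  [forall i, (e i <= i)%N].

Definition avoids102 n (e : {ffun 'I_n -> 'I_n}) : bool :=
  [forall i : 'I_n, forall j : 'I_n, forall k : 'I_n,
     (i < j < k)%N ==> ~~ (e j < e i < e k)%N].

Definition maxe n (e : {ffun 'I_n -> 'I_n}) : nat := (\max_(i < n) e i)%N.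

(* Extension of e by the convention e_{n+1} = -1. *)
Definition entry n (e : {ffun 'I_n -> 'I_n}) (i : nat) : int :=
  if insub i is Some k then ((e k : nat)%:Z)%R else (-1)%R.

(* [find] returns the 0-based index of the first descent; the successor turns
   it into a position in 1, ..., n. *)
Definition fdes n (e : {ffun 'I_n -> 'I_n}) : nat :=
  (find (fun i => (entry e i.+1 < entry e i)%R) (iota 0 n)).+1.

Definition rank n (e : {ffun 'I_n -> 'I_n}) : int :=
  ((fdes e)%:Z - (maxe e)%:Z - 1)%R.

Definition IS102 (n t : nat) : {set {ffun 'I_n -> 'I_n}} :=
  [set e | [&& is_invseq e, avoids102 e & (rank e == t%:Z)%R]].

Inductive step : Type := U | D | V.

Definition step_to_ord (s : step) : 'I_3 :=
  match s with
  | U => @Ordinal 3 0 isT | D => @Ordinal 3 1 isT | V => @Ordinal 3 2 isT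
  end.
Definition step_of_ord (i : 'I_3) : step :=
  match val i with 0 => U | 1 => D | _ => V end.
Lemma step_to_ordK : cancel step_to_ord step_of_ord.
Proof. by case. Qed.

HB.instance Definition _ := Finite.copy step (can_type step_to_ordK).

Definition disp (s : step) : int * int :=
  match s with U => (1, 1) | D => (1, -1) | V => (0, -2) end%R.

Definition point (s : seq step) (k : nat) : int * int :=
  (\sum_(x <- take k s) disp x)%R.

Definition is_uvd (n : nat) (s : seq step) : bool :=
  [&& point s (size s) == (((2 * n)%N%:Z)%R, 0%R),
      all (fun k => (0 <= (point s k).2)%R) (iota 0 (size s).+1),
      ~~ infix [:: U; V] s, ~~ infix [:: V; U] s & suffix [:: D] s].

(* The default V of [nth] is neither D nor U, so out-of-range indices do not
   contribute. *)
Definition vox (s : seq step) : nat :=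
  count (fun k => [&& nth V s k == D, nth V s k.+1 == U
                    & (point s k.+1).2 == 0%R]) (iota 0 (size s)).

(* Bounding the number of steps by 3n excludes no path. *)
Lemma is_uvd_size n s : is_uvd n s -> (size s <= 3 * n)%N.
Proof.
case/andP=> /eqP; rewrite /point take_size => E _.
suff [a [b [c [E1 E2]]]] : exists a b c : nat,
  size s = (a + b + c)%N /\
  (\sum_(x <- s) disp x)%R = (a%:Z + b%:Z, a%:Z - b%:Z - 2 * c%:Z)%R.
  by rewrite E1; move: E; rewrite E2 => -[]; lia.
elim: s {E} => [|x s [a [b [c [E1 E]]]]].
  by exists 0, 0, 0; rewrite big_nil.
rewrite big_cons E /= E1; case: x => /=.
- by exists a.+1, b, c; split; [lia | congr (_, _) => /=; lia].
- by exists a, b.+1, c; split; [lia | congr (_, _) => /=; lia].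
- by exists a, b, c.+1; split; [lia | congr (_, _) => /=; lia].
Qed.

Definition UVD (n t : nat) : {set (3 * n).-bseq step} :=
  [set s : (3 * n).-bseq step | is_uvd n s && (vox s == t)].

(* Main.v *)
(* Let W be the power series with W (1 - W)^2 = z, z = x - x^2. Then W = z T(z)^2
   with T = 1 + z T^3, and expanding W^(t+1) = z^(t+1) T(z)^(2t+2) by the
   Fuss-Catalan formula shows that the sum of the theorem is [x^n] W^(t+1). Both
   families are counted by this coefficient.

   UVD paths with t axis valleys split into t + 1 arches. Read from right to
   left, they descend by unit steps only, and the first-passage decomposition
   gives linear recurrences (by the last step read) solved by W^t / (1 - W)^h.

   Deleting the entry at the first descent, which is the maximum m, makes the
   102-avoiding inversion sequences into a generating tree. Let t be the rank and
   k the (0-based) position of the first m, minus m. A sequence with label (t, k)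
   has one child with label (t + 1, k), and for each s <= t it has
   t - s + 1 + [s < k] children with label (s, s). The resulting recurrence for
   the numbers of sequences of rank s and of excess k > s is solved by
   W^(s+1) and x (W^(s+1) - x W^s) / (1 - W)^3. *)
Require Import Defs.
From mathcomp Require Import all_boot all_order all_algebra.
From mathcomp Require Import zify ring.

Set Implicit Arguments.
Unset Strict Implicit.
Unset Printing Implicit Defensive.

Import Order.TTheory GRing.Theory Num.Theory.

(** * The generating tree of 102-avoiding inversion sequences *)

Local Notation "e `_ i" := (nth 0 e i) : nat_scope.

Definition invseq102 n (e : seq nat) :=
  [/\ size e = n, forall i, i < n -> e`_i <= i
    & forall i j k, i < j < k -> k < n -> e`_j < e`_i < e`_k -> False].

(** The disjunct [size e <= i.+1] encodes the convention $e_{n+1}=-1$: the last position counts as a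
    descent. *)
Definition first_desc (e : seq nat) :=
  find (fun i => (size e <= i.+1) || (e`_i.+1 < e`_i)) (iota 0 (size e)).

Definition is_first_desc (e : seq nat) p :=
  [/\ p < size e, forall i, i < p -> e`_i <= e`_i.+1
    & p.+1 < size e -> e`_p.+1 < e`_p].

Lemma is_first_descP e p : is_first_desc e p -> first_desc e = p.
Proof.
case=> lt_p le_p gt_p; apply/eqP; rewrite eqn_leq; apply/andP; split.
  rewrite leqNgt; apply/negP => /(before_find 0).
  by rewrite nth_iota // add0n; lia.
rewrite leqNgt; apply/negP => lt_f.
have hasP : has (fun i => (size e <= i.+1) || (e`_i.+1 < e`_i)) (iota 0 (size e)).
  by rewrite has_find size_iota; apply: ltn_trans lt_p.
have := nth_find 0 hasP; rewrite -/(first_desc e) nth_iota ?(ltn_trans lt_f) // add0n.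
by have := le_p _ lt_f; lia.
Qed.

Lemma first_descP e : 0 < size e -> is_first_desc e (first_desc e).
Proof.
move=> e0.
have hasP : has (fun i => (size e <= i.+1) || (e`_i.+1 < e`_i)) (iota 0 (size e)).
  apply/hasP; exists (size e).-1; first by rewrite mem_iota; lia.
  by rewrite prednK ?leqnn.
have lt : first_desc e < size e by move: hasP; rewrite has_find size_iota.
split=> // [i lt_i|lt'].
  have := before_find 0 lt_i; rewrite nth_iota ?add0n; last exact: ltn_trans lt.
  by lia.
by have := nth_find 0 hasP; rewrite -/(first_desc e) nth_iota // add0n; lia.
Qed.

Lemma is_first_desc_sorted e p i j :
  is_first_desc e p -> i <= j -> j <= p -> e`_i <= e`_j.
Proof.
case=> _ le_p _; elim: j => [|j IH]; first by rewrite leqn0 => /eqP->.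
rewrite leq_eqVlt => /predU1P[-> //|lt_ij lt_jp].
by apply: leq_trans (le_p _ lt_jp); apply: IH; lia.
Qed.

(** An entry after [p] that exceeds the one at [p] would lie beyond [p.+1] and form the pattern 102
    with the entries at [p] and [p.+1]. *)
Lemma invseq102_max n e p i :
  invseq102 n e -> is_first_desc e p -> i < n -> e`_i <= e`_p.
Proof.
move=> [sz _ av] fd lt_in; have [lt_p _ gt_p] := fd.
case: (leqP i p) => [le_ip|lt_pi]; first exact: is_first_desc_sorted fd _ _.
case: (ltngtP i p.+1) => [|lt|->]; [lia| |lia].
by rewrite leqNgt; apply/negP => gt; apply: (av p p.+1 i); lia.
Qed.

(** * Insertion and deletion of the entry at the first descent *)

Definition insert q y (e : seq nat) := take q e ++ y :: drop q e.
Definition delete p (e : seq nat) := take p e ++ drop p.+1 e.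

Lemma size_insert q y e : size (insert q y e) = (size e).+1.
Proof. by rewrite size_cat /= addnS -size_cat cat_take_drop. Qed.

Lemma nth_insert q y e i : q <= size e ->
  (insert q y e)`_i = if i < q then e`_i else if i == q then y else e`_i.-1.
Proof.
move=> le; rewrite nth_cat size_takel //; case: ltnP => [lt|ge]; first by rewrite nth_take.
move: ge; rewrite leq_eqVlt eq_sym; case: eqP => [->|_ /= lt]; first by rewrite subnn.
by case E : (i - q) => [|k] /=; [|rewrite nth_drop; congr nth]; lia.
Qed.

Lemma size_delete p e : p < size e -> size (delete p e) = (size e).-1.
Proof. by move=> lt; rewrite size_cat size_drop size_takel; lia. Qed.

Lemma nth_delete p e i : p < size e ->
  (delete p e)`_i = if i < p then e`_i else e`_i.+1.
Proof.
move=> lt; rewrite nth_cat size_takel ?(ltnW lt) //.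
by case: ltnP => [?|ge]; [rewrite nth_take | rewrite nth_drop; congr nth; lia].
Qed.

Lemma insertK q y e : q <= size e -> delete q (insert q y e) = e.
Proof.
move=> le; apply: (@eq_from_nth _ 0) => [|i _].
  by rewrite size_delete size_insert.
rewrite nth_delete ?size_insert // !nth_insert //.
by case: ltnP => // ge; rewrite ltnNge (leq_trans ge) //= eq_sym ltn_eqF.
Qed.

Lemma deleteK p e : p < size e -> insert p e`_p (delete p e) = e.
Proof.
move=> lt; have sd := size_delete lt.
apply: (@eq_from_nth _ 0) => [|i _]; first by rewrite size_insert sd; lia.
rewrite nth_insert ?sd; last lia.
rewrite !nth_delete //; case: ltngtP => [//|gt|-> //].
by case: ltnP; [lia | rewrite prednK //; lia].
Qed.

(** An entry shifted left is at most the deleted maximum, hence at most [p], so it keeps its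
    bound. *)
Lemma invseq102_delete n e p :
  invseq102 n.+1 e -> is_first_desc e p -> invseq102 n (delete p e).
Proof.
move=> ok fd; have [sz le_e av] := ok; have [lt_p le_p gt_p] := fd.
have mx i : i < n.+1 -> e`_i <= e`_p by apply: invseq102_max fd.
split=> [|i lt_i|i j k ijk lt_k].
- by rewrite size_delete // sz.
- rewrite nth_delete //; case: ltnP => [_|ge]; first by apply: le_e; lia.
  by apply: leq_trans (mx _ _) (leq_trans (le_e _ _) ge); lia.
- rewrite !nth_delete //.
  (* [f] sends an index of the shortened sequence to its old index; it is increasing, so patterns
     lift to [e]. *)
  pose f x := if x < p then x else x.+1.
  have E x : (if x < p then e`_x else e`_x.+1) = e`_(f x) by rewrite /f; case: ifP.
  by rewrite !E; apply: av; rewrite /f; case: (ltnP i p); case: (ltnP j p); case: (ltnP k p); lia.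
Qed.

(* The pairs (q, y) for which [insert q y e] is again a 102-avoider whose first
   descent is at q: [insert] is then inverse to deleting the entry at the first
   descent. *)
Definition insertable (e : seq nat) q y :=
  [&& q <= (first_desc e).+1, e`_(first_desc e) <= y <= q
    & (q <= first_desc e) ==> (e`_q < y)].

Section Child.
Variables (n : nat) (e : seq nat) (q y : nat).
Hypotheses (ok : invseq102 n e) (e0 : 0 < n) (ins : insertable e q y).
Let p := first_desc e.

Lemma le_insertable_size : q <= size e.
Proof.
have [sz _ _] := ok; have [lt_p _ _] : is_first_desc e p by apply: first_descP; lia.
by case/and3P: ins; rewrite -/p; lia.
Qed.

(** The new entry is a weak maximum, so it could only play the 2 of a pattern; but the entries
    before [q] belong to the initial weakly increasing run. *)
Lemma invseq102_insert : invseq102 n.+1 (insert q y e).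
Proof.
have le_q := le_insertable_size; have [sz le_e av] := ok.
have fd : is_first_desc e p by apply: first_descP; lia.
have mx i : i < n -> e`_i <= e`_p by apply: invseq102_max fd.
case/and3P: ins; rewrite -/p => le_qp /andP[le_my le_yq] lt_y.
split=> [|i lt_i|i j k ijk lt_k].
- by rewrite size_insert sz.
- rewrite nth_insert //; case: ltngtP => [lt|gt|-> //]; first by apply: le_e; lia.
  by apply: leq_trans (le_e i.-1 _) _; lia.
- rewrite !nth_insert //.
  have le_y x : x < n -> e`_x <= y by move=> lt; apply: leq_trans le_my; apply: mx.
  case: (ltngtP k q) => [lt_kq|gt_kq|eq_kq].
  + have [-> ->] : i < q /\ j < q by lia.
    by apply: av; lia.
  + case: (ltngtP i q) => [lt_iq|gt_iq|eq_iq].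
    * case: (ltngtP j q) => [lt_jq|gt_jq|eq_jq].
      - by apply: av; lia.
      - by apply: av; lia.
      - by have := le_y i; lia.
    * have -> : (j < q) = false by lia.
      have -> : (j == q) = false by lia.
      by apply: av; lia.
    * by have := le_y k.-1; lia.
  + have [-> ->] : i < q /\ j < q by lia.
    have := is_first_desc_sorted (i := i) (j := j) fd; lia.
Qed.

Lemma first_desc_insert : first_desc (insert q y e) = q.
Proof.
have le_q := le_insertable_size; have [sz le_e av] := ok.
have fd : is_first_desc e p by apply: first_descP; lia.
have mx i : i < n -> e`_i <= e`_p by apply: invseq102_max fd.
have [lt_p le_p gt_p] := fd.
case/and3P: ins; rewrite -/p => le_qp /andP[le_my le_yq] lt_y.
apply: is_first_descP; split=> [|i lt_i|]; rewrite ?size_insert ?ltnS //.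
  rewrite !nth_insert // lt_i; case: ltngtP => [lt|//|eq]; first by apply: le_p; lia.
  by apply: leq_trans le_my; apply: mx; lia.
move=> lt_q; rewrite !nth_insert // ltnn eqxx.
have [-> ->] : (q.+1 < q) = false /\ (q.+1 == q) = false by lia.
rewrite /=.
case: (leqP q p) => le; first by move: lt_y; rewrite le.
have -> : q = p.+1 by lia.
by apply: leq_trans le_my; apply: gt_p; lia.
Qed.

End Child.

Lemma invseq102_insertable n e p : 0 < n ->
  invseq102 n.+1 e -> is_first_desc e p -> insertable (delete p e) p e`_p.
Proof.
move=> n0 ok fd; have [sz le_e av] := ok; have [lt_p le_p gt_p] := fd.
have mx i : i < n.+1 -> e`_i <= e`_p by apply: invseq102_max fd.
have sd := size_delete lt_p.
have fd' : is_first_desc (delete p e) (first_desc (delete p e)) by apply: first_descP; lia.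
rewrite /insertable; move: (first_desc _) fd' => p' [lt_p' _ gt_p'].
(* Otherwise the descent of the shortened sequence at [p'] would already be a descent of [e] before
   [p]. *)
have le_pp' : p <= p'.+1.
  rewrite leqNgt; apply/negP => lt.
  have := gt_p'; rewrite !nth_delete // lt (ltnW lt) => H.
  by have := H _; have := le_p p'; lia.
apply/and3P; split.
- by [].
- rewrite nth_delete //; apply/andP; split; last by apply: le_e; lia.
  by case: ifP => _; apply: mx; lia.
- by apply/implyP => le; rewrite nth_delete // ltnn; apply: gt_p; lia.
Qed.

(** * Labels and children in the generating tree *)

Definition peak (e : seq nat) := e`_(first_desc e).
(* Both differences are truncated, but nonnegative on inversion sequences. *)
Definition lrank e := first_desc e - peak e.
Definition lexc e := index (peak e) e - peak e.

(* The insertable pairs (q, y) for a sequence with peak m, rank t and excess k.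
   The entries equal to m before the first descent occupy the positions
   m + k, ..., m + t, which excludes y = m for those q. The first pair appends
   to this plateau and gives (t + 1, k) as new rank and excess; a pair with
   q - y = s <= t starts a new plateau and gives (s, s). *)
Definition moves (m t k : nat) : seq (nat * nat) :=
  (m + t.+1, m) :: [seq (m + d, m + d - s) | s <- iota 0 t.+1,
                       d <- iota (s + (k <= s)) (t.+1 - s + (s < k))].

Lemma mem_moves m t k q y : k <= t ->
  ((q, y) \in moves m t k) =
  [&& q <= m + t.+1, m <= y <= q & ~~ [&& m + k <= q, q <= m + t & y == m]].
Proof.
move=> le_kt; rewrite inE xpair_eqE; apply/idP/idP.
  case/orP=> [|/allpairsPdep[s [d [+ + [-> ->]]]]]; first lia.
  rewrite !mem_iota; lia.
move=> H; case: (altP andP) => // N; rewrite orFb.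
apply/allpairsPdep; exists (q - y), (q - m); rewrite !mem_iota.
split; [lia | lia | congr (_, _); lia].
Qed.

Lemma moves_uniq m t k : uniq (moves m t k).
Proof.
rewrite /moves cons_uniq andbC; apply/andP; split.
  apply: allpairs_uniq_dep => [|s _|]; rewrite ?iota_uniq //.
  move=> [s d] [s' d'] /allpairsPdep[a [b [+ + [-> ->]]]] /allpairsPdep[a' [b' [+ + [-> ->]]]] /=.
  rewrite !mem_iota => ? ? ? ? [/addnI eq_b]; rewrite eq_b => ?.
  by have -> : a = a' by lia.
apply/negP => /allpairsPdep[s [d [+ + []]]]; rewrite !mem_iota; lia.
Qed.

(** Level [n] holds the sequences of length [n.+1]; the root is the only one of length 1. *)
Fixpoint gen n : seq (seq nat) :=
  if n is n'.+1 then
    [seq insert x.1 x.2 e | e <- gen n', x <- moves (peak e) (lrank e) (lexc e)]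
  else [:: [:: 0]].

Lemma genS n : gen n.+1 =
  [seq insert x.1 x.2 e | e <- gen n, x <- moves (peak e) (lrank e) (lexc e)].
Proof. by []. Qed.

Section Labels.
Variables (n : nat) (e : seq nat).
Hypothesis ok : invseq102 n.+1 e.

Lemma first_desc_invseq : is_first_desc e (first_desc e).
Proof. by have [sz _ _] := ok; apply: first_descP; rewrite sz. Qed.

Lemma peak_le : peak e <= first_desc e <= n.
Proof.
have [sz le_e _] := ok; have [lt_p _ _] := first_desc_invseq.
by rewrite [_ <= n]leq_eqVlt; apply/andP; split; [apply: le_e|]; lia.
Qed.

Lemma index_peak : peak e <= index (peak e) e <= first_desc e.
Proof.
have [sz le_e _] := ok; have [lt_p _ _] := first_desc_invseq.
have in_e : peak e \in e by apply: mem_nth.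
apply/andP; split; last by rewrite leqNgt; apply/negP => /(before_find 0) /=; rewrite eqxx.
by rewrite -{1}(nth_index 0 in_e); apply: le_e; rewrite -sz index_mem.
Qed.

Lemma nth_eq_peak i : index (peak e) e <= i <= first_desc e -> e`_i = peak e.
Proof.
case/andP=> le1 le2; have [lt_p _ _] := first_desc_invseq.
have in_e : peak e \in e by apply: mem_nth.
apply/eqP; rewrite eqn_leq; apply/andP; split.
  exact: is_first_desc_sorted first_desc_invseq le2 (leqnn _).
rewrite -[X in X <= _](nth_index 0 in_e).
exact: is_first_desc_sorted first_desc_invseq le1 le2.
Qed.

Lemma nth_lt_peak i : i < index (peak e) e -> e`_i < peak e.
Proof.
move=> lt; have /andP[_ le] := index_peak; have [lt_p _ _] := first_desc_invseq.
rewrite ltn_neqAle (negbT (before_find 0 lt)) /=.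
by apply: is_first_desc_sorted first_desc_invseq _ _; lia.
Qed.

(** For [q] up to the first descent and [y] at least the peak, the entry at [q] is below [y] unless
    both equal the peak; the peak fills exactly the positions from its first occurrence to the first
    descent. *)
Lemma mem_moves_insertable q y :
  ((q, y) \in moves (peak e) (lrank e) (lexc e)) = insertable e q y.
Proof.
have /andP[le1 le2] := index_peak; have /andP[le3 le4] := peak_le.
rewrite mem_moves /insertable -/(peak e) /lrank /lexc; last lia.
have -> : peak e + (first_desc e - peak e).+1 = (first_desc e).+1 by lia.
have -> : peak e + (first_desc e - peak e) = first_desc e by lia.
have -> : peak e + (index (peak e) e - peak e) = index (peak e) e by lia.
case: (leqP q (first_desc e)) => le_q /=; last by rewrite !andbF andbT.
case: (leqP (index (peak e) e) q) => le_iq /=.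
  by rewrite nth_eq_peak ?le_iq //; lia.
by have := nth_lt_peak le_iq; lia.
Qed.

Lemma lrank_insert q y : insertable e q y -> lrank (insert q y e) = q - y.
Proof.
move=> ins; rewrite /lrank /peak (first_desc_insert ok) //.
by rewrite nth_insert ?ltnn ?eqxx //; apply: le_insertable_size ok _ ins.
Qed.

(** The value [y] already occurs before [q] only if the insertion extends the plateau of the peak;
    otherwise its first occurrence is [q]. *)
Lemma lexc_insert q y : insertable e q y ->
  lexc (insert q y e) =
  if (q == (first_desc e).+1) && (y == peak e) then lexc e else q - y.
Proof.
move=> ins; have le_q := le_insertable_size ok isT ins.
have sz_t : size (take q e) = q by rewrite size_takel.
have [lt_p _ _] := first_desc_invseq.
have peak_in : peak e \in take (first_desc e).+1 e.
  by apply/(nthP 0); exists (first_desc e); rewrite ?size_takel ?nth_take.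
rewrite /lexc /peak (first_desc_insert ok) // nth_insert ?ltnn ?eqxx //.
rewrite -/(peak e) index_cat sz_t /= eqxx addn0.
case: ifP => [/(nthP 0)[i] | /negP nin].
  rewrite sz_t => lt_i; rewrite nth_take // => eq_y.
  case/and3P: (ins); rewrite -/(peak e) => le_qp /andP[le_my le_yq] /implyP lt_y.
  have eq_q : q = (first_desc e).+1.
    apply/eqP; rewrite eqn_leq le_qp ltnNge; apply/negP => /[dup] le /lt_y.
    have := is_first_desc_sorted first_desc_invseq (ltnW lt_i) le; rewrite eq_y; lia.
  have le_i : e`_i <= peak e by apply: is_first_desc_sorted first_desc_invseq _ _; lia.
  have -> : y = peak e by apply/eqP; rewrite eqn_leq le_my -eq_y le_i.
  rewrite eq_q !eqxx /=; congr (_ - _).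
  by rewrite -[X in _ = index _ X](cat_take_drop (first_desc e).+1 e) index_cat peak_in.
by case: ifP => // /andP[/eqP eq_q /eqP eq_y]; case: nin; rewrite eq_q eq_y.
Qed.

End Labels.

Lemma mem_gen n e : e \in gen n <-> invseq102 n.+1 e.
Proof.
elim: n e => [|n IH] e.
  rewrite inE; split=> [/eqP-> | [sz le_e _]].
    by split=> // [[|i] //|i j k]; lia.
  by case: e sz le_e => [|x [|]] //= _ /(_ 0 isT); case: x.
split=> [/allpairsPdep[e' [[q y] [/IH ok + ->]]] | ok].
  by rewrite (mem_moves_insertable ok) => /=; apply: invseq102_insert.
have fd := first_desc_invseq ok; have ok' := invseq102_delete ok fd.
have ins := invseq102_insertable (ltn0Sn n) ok fd.
apply/allpairsPdep; exists (delete (first_desc e) e), (first_desc e, peak e).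
split; first exact/IH.
  by rewrite (mem_moves_insertable ok').
by rewrite /= deleteK //; case: fd.
Qed.

(** A child determines [q] as its first descent, then [y] as the entry there, then its parent by
    deletion. *)
Lemma gen_uniq n : uniq (gen n).
Proof.
elim: n => // n IH; rewrite genS; apply: allpairs_uniq_dep => // [e _|]; first exact: moves_uniq.
move=> [e1 x1] [e2 x2] /allpairsPdep[e [[q y] [/mem_gen ok + [-> ->]]]].
move=> + /allpairsPdep[e' [[q' y'] [/mem_gen ok' + [-> ->]]]] /=.
rewrite (mem_moves_insertable ok) (mem_moves_insertable ok') => ins ins' eq.
have le_q := le_insertable_size ok isT ins; have le_q' := le_insertable_size ok' isT ins'.
have eq_q : q = q'.
  by rewrite -(first_desc_insert ok isT ins) eq (first_desc_insert ok' isT ins').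
rewrite -{}eq_q in eq le_q' *.
have -> : y = y'.
  have := congr1 (fun e => e`_q) eq; rewrite /= !nth_insert // ltnn eqxx //.
by rewrite -(insertK y le_q) eq insertK.
Qed.

Lemma sum_moves (phi : nat -> nat -> nat) n e : invseq102 n.+1 e ->
  \sum_(x <- moves (peak e) (lrank e) (lexc e))
     phi (lrank (insert x.1 x.2 e)) (lexc (insert x.1 x.2 e)) =
  phi (lrank e).+1 (lexc e)
    + \sum_(0 <= s < (lrank e).+1) ((lrank e).+1 - s + (s < lexc e)) * phi s s.
Proof.
move=> ok; have /andP[le3 le4] := peak_le ok.
have Ep : peak e + (lrank e).+1 = (first_desc e).+1 by rewrite /lrank; lia.
have -> : \sum_(x <- moves (peak e) (lrank e) (lexc e))
     phi (lrank (insert x.1 x.2 e)) (lexc (insert x.1 x.2 e)) =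
   \sum_(x <- moves (peak e) (lrank e) (lexc e))
     phi (x.1 - x.2) (if x == ((first_desc e).+1, peak e) then lexc e else x.1 - x.2).
  apply: eq_big_seq => -[q y]; rewrite (mem_moves_insertable ok) => ins.
  by rewrite /= (lrank_insert ok ins) (lexc_insert ok ins) xpair_eqE.
have := moves_uniq (peak e) (lrank e) (lexc e).
rewrite /moves cons_uniq => /andP[nin _]; rewrite big_cons /= Ep eqxx.
congr (phi _ _ + _); first by rewrite /lrank; lia.
rewrite Ep in nin.
transitivity (\sum_(x <- [seq (peak e + d, peak e + d - s) | s <- iota 0 (lrank e).+1,
      d <- iota (s + (lexc e <= s)) ((lrank e).+1 - s + (s < lexc e))])
    phi (x.1 - x.2) (x.1 - x.2)).
  by apply: eq_big_seq => x xin; case: eqP => // E; rewrite -E xin in nin.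
rewrite big_allpairs_dep /index_iota subn0; apply: eq_bigr => s _ /=.
rewrite big_seq_cond (eq_bigr (fun=> phi s s)) => [|d]; last first.
  by rewrite mem_iota => H; congr phi; lia.
by rewrite -big_seq_cond big_const_seq count_predT size_iota iter_addn_0 mulnC.
Qed.

(** * Recurrences for sums over the labels *)

Definition stat (phi : nat -> nat -> nat) n :=
  \sum_(e <- gen n) phi (lrank e) (lexc e).

Lemma statS phi n :
  stat phi n.+1 = stat (fun t k => phi t.+1 k
    + \sum_(0 <= s < t.+1) (t.+1 - s + (s < k)) * phi s s) n.
Proof.
rewrite /stat genS big_allpairs_dep; apply: eq_big_seq => e /mem_gen ok.
exact: sum_moves ok.
Qed.

Lemma eq_stat phi psi n :
  (forall t k, k <= t <= n -> phi t k = psi t k) -> stat phi n = stat psi n.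
Proof.
move=> H; apply: eq_big_seq => e /mem_gen ok; apply: H.
have := peak_le ok; have := index_peak ok; rewrite /lexc /lrank; lia.
Qed.

Lemma statD phi psi n : stat (fun t k => phi t k + psi t k) n = stat phi n + stat psi n.
Proof. by rewrite /stat big_split. Qed.

Lemma stat0 phi n : (forall t k, t <= n -> phi t k = 0) -> stat phi n = 0.
Proof.
move=> H; transitivity (stat (fun _ _ => 0) n); last by rewrite /stat big1.
by apply: eq_stat => t k /andP[_ /H].
Qed.

Definition nrank s := stat (fun t _ => t == s).
Definition nrank_ge s := stat (fun t _ => s <= t).
(** The truncated [t.+1 - s] counts the [r] from [s] to [t], so this is the sum of [nrank_ge r] over
    all [r >= s]. *)
Definition nrank_sum s := stat (fun t _ => t.+1 - s).
Definition nexc_gt s := stat (fun _ k => s < k).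

Lemma nrank_geE s n : nrank_ge s n = nrank s n + nrank_ge s.+1 n.
Proof. by rewrite -statD; apply: eq_stat => t k _; case: ltngtP. Qed.

Lemma nrank_sumE s n : nrank_sum s n = nrank_ge s n + nrank_sum s.+1 n.
Proof. by rewrite -statD; apply: eq_stat => t k _; lia. Qed.

Lemma nrankS s n : nrank s n.+1 =
  nrank_sum s n + nexc_gt s n + (if s is s'.+1 then nrank s' n else 0).
Proof.
rewrite /nrank statS.
transitivity (stat (fun t k => (t.+1 - s + (s < k)) + (t.+1 == s)) n).
  apply: eq_stat => t k /andP[le_kt _]; rewrite addnC; congr (_ + _).
  case: (leqP s t) => [le|lt].
    rewrite (bigD1_seq s) ?iota_uniq ?mem_index_iota //= eqxx muln1 big1 ?addn0 //.
    by move=> i /negPf->; rewrite muln0.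
  (* For [s > t] the weight vanishes too, since [k <= t < s]. *)
  rewrite big_nat big1; first lia.
  by move=> i /andP[_ lt_i]; case: eqP; [lia | rewrite muln0].
rewrite !statD; congr (_ + _); case: s => [|s] //.
by apply: stat0.
Qed.

(** Children that start a new plateau have excess equal to rank and cancel; only the child extending
    the plateau, labelled [(t.+1, k)], makes a difference. *)
Lemma nexc_gtS s n :
  nexc_gt s n.+1 + nrank_ge s n = nexc_gt s n + nrank_ge s.+1 n.+1.
Proof. by rewrite /nexc_gt /nrank_ge !statS -!statD; apply: eq_stat => t k _; lia. Qed.

Local Open Scope ring_scope.

(** * Coefficients of the powers of W *)

(* [x^m] T^k for T = 1 + x T^3, that is k/(3m+k) binom(3m+k, m), as a difference
   of binomials to avoid the division. *)
Definition fuss (m k : nat) : int :=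
  'C(3 * m + k - 1, m)%:Z
    - 2 * (if m is m'.+1 then 'C(3 * m + k - 1, m')%:Z else 0).

Lemma fuss0 k : fuss 0 k = 1.
Proof. by rewrite /fuss bin0. Qed.

(** Coefficient form of $T^{k+1}=T^k+xT^{k+3}$, by Pascal's rule. *)
Lemma fussS m k : fuss m.+1 k.+1 = fuss m.+1 k + fuss m k.+3.
Proof.
rewrite /fuss.
have -> : (3 * m.+1 + k.+1 - 1 = (3 * m + k + 2).+1)%N by lia.
have -> : (3 * m.+1 + k - 1 = 3 * m + k + 2)%N by lia.
have -> : (3 * m + k.+3 - 1 = 3 * m + k + 2)%N by lia.
by case: m => [|m]; rewrite ?binS ?bin0; lia.
Qed.

Lemma fuss_m0 m : fuss m.+1 0 = 0.
Proof.
rewrite /fuss.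
have := mul_bin_left (3 * m.+1 + 0 - 1) m.
have -> : (3 * m.+1 + 0 - 1 - m = 2 * m.+1)%N by lia.
nia.
Qed.

(** [mul_bin_left] gives the ratio of the two binomials in [fuss]; since the exponent is even, a
    factor 2 cancels. *)
Lemma fuss_closed m t :
  (m + t.+1)%:Z * fuss m t.+1.*2 = t.+1%:Z * 'C(3 * m + t.*2.+1, m)%:Z.
Proof.
rewrite /fuss; case: m => [|m]; first by rewrite !bin0; lia.
have -> : (3 * m.+1 + t.+1.*2 - 1 = 3 * m.+1 + t.*2.+1)%N by lia.
have := mul_bin_left (3 * m.+1 + t.*2.+1) m.
have -> : (3 * m.+1 + t.*2.+1 - m = 2 * (m.+1 + t.+1))%N by lia.
nia.
Qed.

(* [x^n] z^j for z = x - x^2. *)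
Definition zc (n j : nat) : int :=
  if (j <= n)%N then (-1) ^+ (n - j) * 'C(j, n - j)%:Z else 0.

Lemma zc00 n : zc n 0 = (n == 0)%:Z.
Proof. by rewrite /zc subn0; case: n => [|n] //=; rewrite bin0n mulr0. Qed.

Lemma zc1S j : zc 1 j.+1 = zc 0 j.
Proof. by rewrite /zc ltnS subSS; case: j => [|j]. Qed.

Lemma zcSS n j : zc n.+2 j.+1 = zc n.+1 j - zc n j.
Proof.
rewrite /zc ltnS; case: (leqP j n) => [le_jn|lt_nj].
  rewrite (leqW le_jn) subSS subSn // binS exprS; lia.
rewrite subr0 subSS; case: leqP => // le_jn.
have -> : j = n.+1 by lia.
by rewrite subnn !bin0.
Qed.

(* [x^n] z^t T(z)^k. In terms of W = z T(z)^2 and T(z) = 1/(1 - W), this is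
   the coefficient of W^t/(1 - W)^h for k = 2t + h. *)
Definition wc (n k t : nat) : int :=
  \sum_(t <= j < n.+1) zc n j * fuss (j - t) k.

(* Extending [wc] by 0 to negative n lets [wz_z] hold without case distinctions. *)
Definition wz (i : int) (k t : nat) : int := if i is Posz n then wc n k t else 0.
Arguments wz : simpl never.

Lemma wc_small n k t : (n < t)%N -> wc n k t = 0.
Proof. by move=> lt; rewrite /wc big_geq. Qed.

(** For $k=2t+h$ this reads $W^t/(1-W)^{h+1}=W^t/(1-W)^h+W^{t+1}/(1-W)^{h+1}$. *)
Lemma wc_T n k t : wc n k.+1 t = wc n k t + wc n k.+3 t.+1.
Proof.
case: (ltnP n t) => [lt|le]; first by rewrite !wc_small ?addr0; lia.
rewrite /wc big_ltn // [X in _ = X + _]big_ltn // subnn !fuss0 -addrA.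
congr (_ + _); rewrite -big_split /= !big_nat; apply: eq_bigr => j /andP[lt_tj _].
by rewrite -mulrDr subnS -(prednK (n := j - t)%N) ?subn_gt0 //= fussS.
Qed.

(** One factor of $z^{t+1}$ is expanded as $x-x^2$. *)
Lemma wc_z n k t : wc n.+2 k t.+1 = wc n.+1 k t - wc n k t.
Proof.
rewrite /wc big_add1 /=.
have -> : \sum_(t <= j < n.+1) zc n j * fuss (j - t) k =
          \sum_(t <= j < n.+2) zc n j * fuss (j - t) k.
  case: (leqP t n.+1) => [le|lt]; last by rewrite !big_geq //; lia.
  by rewrite [RHS]big_nat_recr //= [zc n n.+1]/zc ltnn mul0r addr0.
rewrite -sumrB; apply: eq_bigr => j _.
by rewrite zcSS subSS mulrBl.
Qed.

Lemma wz_T i k t : wz i k.+1 t = wz i k t + wz i k.+3 t.+1.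
Proof. by case: i => n //; exact: wc_T. Qed.

Lemma wz_z i k t : wz i k t.+1 = wz (i - 1) k t - wz (i - 2) k t.
Proof.
case: i => [[|[|n]]|n]; last by [].
- by rewrite /wz /= wc_small.
- by rewrite /wz /= /wc big_add1 /= subr0; apply: eq_bigr => j _; rewrite zc1S subSS.
- have -> : n.+2%:Z - 1 = n.+1 by lia.
  have -> : n.+2%:Z - 2 = n by lia.
  exact: wc_z.
Qed.

Lemma wz_00 i : wz i 0 0 = (i == 0)%:Z.
Proof.
case: i => n //; rewrite /wz /wc big_ltn // big1_seq ?addr0 => [|j].
  by rewrite fuss0 mulr1 zc00.
by rewrite mem_index_iota => /andP[_ /andP[]]; case: j => // j _ _; rewrite fuss_m0 mulr0.
Qed.

(** * UVD paths *)

(** Finite counting on an infinite type, so that the recursion on paths needs no length bound;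
    integer values allow the subtraction in [uvd_cnt]. *)
Definition count_is (T : eqType) (P : pred T) (z : int) :=
  exists2 L : seq T, uniq L & (L =i P) /\ (size L)%:Z = z.

(* Reads a path from right to left: [st] is the step just read, [h] the current
   height, [n] the number of down steps (d or v) and [t] the number of valleys on
   the axis still to be read. Read this way the path only descends by unit steps
   (its u steps), so that a descent from height h splits at the first visits of
   the heights h - 1, ..., 0. *)
Fixpoint uvd_acc (st : step) (h n t : nat) (s : seq step) : bool :=
  match s with
  | [::] => [&& h == 0, n == 0 & t == 0]%N
  | U :: s' => [&& st != V, 0 < h & uvd_acc U h.-1 n t s']%N
  | D :: s' => let b := ((h == 0) && (st == U))%N in
               [&& 0 < n, b <= t & uvd_acc D h.+1 n.-1 (t - b) s']%N
  | V :: s' => [&& st != U, 0 < n & uvd_acc V h.+2 n.-1 t s']%N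
  end.

(* Coefficients of x^n in W^t A^h, W^(t+1) A^(h-1) / x and
   W^(t+1) A^(h-1) / x - W^t A^(h-1), where A = 1/(1 - W). *)
Definition uvd_cnt (st : step) (h n t : nat) : int :=
  match st with
  | U => wz n (2 * t + h) t
  | D => wz (n%:Z + 1) (2 * t + h.+1) t.+1
  | V => wz (n%:Z + 1) (2 * t + h.+1) t.+1 - wz n (2 * t + h.-1) t
  end.

Lemma count_is_cons (P PU PD PV : pred (seq step)) (b : bool) (u d v : int) :
  P [::] = b ->
  (forall s, P (U :: s) = PU s) -> (forall s, P (D :: s) = PD s) ->
  (forall s, P (V :: s) = PV s) ->
  count_is PU u -> count_is PD d -> count_is PV v ->
  count_is P (b%:Z + u + d + v).
Proof.
move=> P0 hU hD hV [LU uU [mU sU]] [LD uD [mD sD]] [LV uV [mV sV]].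
pose L := nseq b [::] ++ map (cons U) LU ++ map (cons D) LD ++ map (cons V) LV.
have memc x y (l : seq (seq step)) s :
    (x :: s \in map (cons y) l) = (x == y) && (s \in l).
  case: eqP => [->|ne]; first by rewrite mem_map // => ? ? [].
  by apply/mapP => -[? _ [/ne]].
have memn y (l : seq (seq step)) : ([::] \in map (cons y) l) = false.
  by apply/mapP => -[].
have mL s : (s \in L) = P s.
  rewrite /L !mem_cat mem_nseq; case: s => [|x s].
    by rewrite !memn P0 eqxx andbT !orbF lt0b.
  by rewrite !memc andbF; case: x; rewrite /= ?hU ?hD ?hV ?mU ?mD ?mV ?orbF.
exists L; last split => //.
  have inj y : injective (cons y : seq step -> _) by move=> ? ? [].
  rewrite !cat_uniq !has_cat !map_inj_uniq // uU uD uV !andbT.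
  have dis x y (l l' : seq (seq step)) :
      x != y -> has [in map (cons x) l] (map (cons y) l') = false.
    move=> ne; apply/hasP => -[_ /mapP[s _ ->]] /=.
    by rewrite memc eq_sym (negPf ne).
  have dis0 x (l : seq (seq step)) : has [in nseq b [::]] (map (cons x) l) = false.
    by apply/hasP => -[_ /mapP[s _ ->]] /=; rewrite mem_nseq andbF.
  by rewrite !dis // !dis0 /= andbT; case: (b).
by rewrite /L !size_cat !size_map size_nseq !PoszD !addrA sU sD sV.
Qed.

Lemma count_is0 (T : eqType) (P : pred T) : P =1 pred0 -> count_is P 0.
Proof. by move=> P0; exists [::] => //; split=> // s; rewrite [RHS]P0. Qed.

Lemma count_is_eq (T : eqType) (P Q : pred T) z z' :
  P =1 Q -> z = z' -> count_is Q z -> count_is P z'.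
Proof.
move=> PQ <- [L uL [mL sL]]; exists L => //; split=> // s.
by rewrite mL [LHS]/= -[RHS]/(P s) PQ.
Qed.

Lemma wz0S k t : wz 0 k t.+1 = 0.
Proof. by rewrite /wz /= wc_small. Qed.

(** Reading [D] or [V] leads to a positive height, which is why the formulas of these states are
    claimed only there. *)
Lemma uvd_acc_count st h n t :
  (st != U -> 0 < h)%N -> count_is (uvd_acc st h n t) (uvd_cnt st h n t).
Proof.
(* The measure drops by 1 on [U], by 2 on [D] and by 1 on [V]. *)
have [m] := ubnP (3 * n + h)%N.
elim: m => // m IH in st h n t * => lt_m hst.
have Hu : (st != V)%N -> (0 < h)%N -> count_is (uvd_acc U h.-1 n t) (uvd_cnt U h.-1 n t).
  by move=> _ h0; apply: IH => //; lia.
have Hd t' : (0 < n)%N -> count_is (uvd_acc D h.+1 n.-1 t') (uvd_cnt D h.+1 n.-1 t').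
  by move=> n0; apply: IH => //; lia.
have Hv : (0 < n)%N -> count_is (uvd_acc V h.+2 n.-1 t) (uvd_cnt V h.+2 n.-1 t).
  by move=> n0; apply: IH => //; lia.
pose z (b : bool) (x : int) := if b then x else 0.
have guard (T : eqType) (b : bool) (P : pred T) x : (b -> count_is P x) -> count_is (fun s => b && P s) (z b x).
  by case: b => // H; [exact: H | exact: count_is0].
pose b := ((h == 0) && (st == U))%N.
have := @count_is_cons (uvd_acc st h n t)
  (fun s => [&& st != V, 0 < h & uvd_acc U h.-1 n t s])%N
  (fun s => [&& 0 < n, b <= t & uvd_acc D h.+1 n.-1 (t - b) s])%N
  (fun s => [&& st != U, 0 < n & uvd_acc V h.+2 n.-1 t s])%N
  [&& h == 0, n == 0 & t == 0]%N
  (z (st != V) (z (0 < h)%N (uvd_cnt U h.-1 n t)))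
  (z (0 < n)%N (z (b <= t)%N (uvd_cnt D h.+1 n.-1 (t - b))))
  (z (st != U) (z (0 < n)%N (uvd_cnt V h.+2 n.-1 t))) erefl
  (fun=> erefl) (fun=> erefl) (fun=> erefl).
move=> H; apply: count_is_eq (H _ _ _) => //; last first.
- by do 2!apply: (guard) => ?; apply: Hv.
- by do 2!apply: (guard) => ?; apply: Hd.
- by do 2!apply: (guard) => ?; apply: Hu.
rewrite /z /b => {H Hu Hd Hv guard IH z b lt_m m}.
(* The guard [0 < n] is absorbed because $W^{t+1}$ has no constant term. *)
have zD h' t' : (if (0 < n)%N then uvd_cnt D h' n.-1 t' else 0) =
    wz n (2 * t' + h'.+1) t'.+1.
  by case: n => [|n]; [by rewrite wz0S | rewrite /uvd_cnt ltn0Sn; congr wz; lia].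
have zV : (if (0 < n)%N then uvd_cnt V h.+2 n.-1 t else 0) =
    wz n (2 * t + h).+3 t.+1 - wz (n%:Z - 1) (2 * t + h).+1 t.
  case: n {zD} => [|n]; first by rewrite wz0S.
  rewrite /uvd_cnt ltn0Sn; congr (wz _ _ _ - wz _ _ _); lia.
rewrite zV {zV}.
case: (ltnP 0 h) hst => [h0 _|].
  have -> : (h == 0)%N = false by lia.
  rewrite andFb subn0 zD add0r; case: h h0 => // h _; rewrite [h.+1.-1]/=.
  have T1 := wz_T n (2 * t + h) t; have T2 := wz_T n (2 * t + h).+1 t.
  have Z0 := wz_z (n%:Z + 1) (2 * t + h).+2 t.
  have E1 : n%:Z + 1 - 1 = n by lia.
  have E2 : n%:Z + 1 - 2 = n%:Z - 1 by lia.
  rewrite E1 E2 in Z0.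
  have U0 : uvd_cnt U h n t = wz n (2 * t + h) t by [].
  have U1 : uvd_cnt U h.+1 n t = wz n (2 * t + h).+1 t by rewrite /uvd_cnt addnS.
  have D1 : uvd_cnt D h.+1 n t = wz (n%:Z + 1) (2 * t + h).+2 t.+1.
    by rewrite /uvd_cnt !addnS.
  have V1 : uvd_cnt V h.+1 n t = wz (n%:Z + 1) (2 * t + h).+2 t.+1 - wz n (2 * t + h) t.
    by rewrite /uvd_cnt !addnS.
  rewrite !addnS; case: st; rewrite ?U0 ?U1 ?D1 ?V1 ?Z0 /=; lia.
(* At height 0 the state is [U], so only [D] can be read, and it uses up one axis valley. *)
rewrite leqn0 => /eqP-> {h}; case: st => [_|/(_ isT)|/(_ isT)] //.
rewrite addn0; case: t => [|t].
  by rewrite /= andbT if_same !addr0 wz_00.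
rewrite -[LHS]/(((n == 0)%N && false)%:Z + 0 +
  (if (0 < n)%N then uvd_cnt D 1 n.-1 (t.+1 - 1) else 0) + 0).
rewrite zD andbF subSS subn0 !addr0 add0r; congr wz; lia.
Qed.

(** * Correspondence between [uvd_acc] and lattice paths *)

Lemma point_rcons p x k : (k <= size p)%N -> point (rcons p x) k = point p k.
Proof. by move=> le; rewrite /point -cats1 takel_cat. Qed.

Lemma point_size p : point p (size p) = \sum_(x <- p) disp x.
Proof. by rewrite /point take_size. Qed.

Lemma point_rcons_size p x :
  point (rcons p x) (size p).+1 = point p (size p) + disp x.
Proof. by rewrite -(size_rcons p x) !point_size big_rcons. Qed.

Definition stays_nonneg (p : seq step) :=
  all (fun k => (0 <= (point p k).2)%R) (iota 0 (size p).+1).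

Lemma stays_nonneg_rcons p x :
  stays_nonneg (rcons p x) =
  stays_nonneg p && (0 <= (point (rcons p x) (size p).+1).2).
Proof.
rewrite /stays_nonneg size_rcons -addn1 iotaD all_cat [all _ (iota (0 + _) 1)]/= andbT; congr (_ && _).
apply: eq_in_all => k; rewrite mem_iota => /andP[_ lt_k].
by rewrite point_rcons //; lia.
Qed.

Lemma infix2_rcons (a b x y : step) p :
  infix [:: a; b] (rcons (rcons p y) x) =
  infix [:: a; b] (rcons p y) || (y == a) && (x == b).
Proof.
have rconsE q z : infix [:: a; b] (rcons q z) = infix [:: b; a] (z :: rev q).
  by rewrite -infix_rev rev_rcons.
rewrite !rconsE infix_consl rev_rcons /= prefix0s andbT orbC.
by congr (_ || _); rewrite andbC (eq_sym b) (eq_sym a).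
Qed.

Lemma vox_rcons p y x :
  vox (rcons (rcons p y) x) =
  (vox (rcons p y) + [&& y == D, x == U & (point (rcons p y) (size p).+1).2 == 0])%N.
Proof.
(* The last index never counts: the entry after it is the default [V]. *)
have H s z : vox (rcons s z) = count (fun k => [&& nth V (rcons s z) k == D,
    nth V (rcons s z) k.+1 == U & (point s k.+1).2 == 0]) (iota 0 (size s)).
  have nV : nth V (rcons s z) (size s).+1 = V by rewrite nth_default ?size_rcons.
  rewrite /vox size_rcons -addn1 iotaD count_cat /= add0n nV andbF !addn0.
  apply: eq_in_count => k; rewrite mem_iota => /andP[_ lt_k].
  by rewrite point_rcons.
rewrite !H size_rcons -addn1 iotaD count_cat; congr (_ + _)%N.
  apply: eq_in_count => k; rewrite mem_iota => /andP[_ lt_k].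
  rewrite add0n in lt_k.
  by rewrite !(nth_rcons _ (rcons p y)) size_rcons ltnS (ltnW lt_k) ltnS lt_k point_rcons.
rewrite /= add0n addn0 !nth_rcons !size_rcons !ltnn !ltnSn !eqxx.
by rewrite addn1.
Qed.

Lemma stays_nonneg_end p : stays_nonneg p -> 0 <= (point p (size p)).2.
Proof. by move/allP; apply; rewrite mem_iota /=. Qed.

(** The difference of the coordinates grows by 2 with each d or v and is unchanged by u, so it is
    twice the number of down steps. *)
Lemma point_downs p : 0 <= (point p (size p)).1 - (point p (size p)).2.
Proof.
elim/last_ind: p => [|p x IH]; first by rewrite point_size big_nil.
by rewrite size_rcons point_rcons_size; case: x => /=; lia.
Qed.

(** The step [st] follows [p] in the path, so forbidden pairs and valleys across the junction are
    those of [rcons p st]. *)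
Lemma uvd_acc_rev st h n t p :
  uvd_acc st h n t (rev p) =
  [&& (point p (size p)).2 == h%:Z,
      (point p (size p)).1 - (point p (size p)).2 == (2 * n)%N%:Z, stays_nonneg p,
      ~~ infix [:: U; V] (rcons p st), ~~ infix [:: V; U] (rcons p st)
    & vox (rcons p st) == t].
Proof.
elim/last_ind: p => [|p x IH] in st h n t *.
  rewrite point_size big_nil /stays_nonneg /= /vox /point big_nil /= andbF /=.
  rewrite !andbF /=; case: st; lia.
rewrite rev_rcons size_rcons stays_nonneg_rcons !infix2_rcons vox_rcons.
rewrite !point_rcons_size.
have := @stays_nonneg_end p; have := point_downs p.
case: x; rewrite /= !IH; case: (point p (size p)) => a b /= => {IH};
  move: (stays_nonneg p) (infix _ _) (infix _ _) (vox _) (st == U) (st == V).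
- move=> p0 i1 i2 v b1 b2; lia.
- move=> p0 i1 i2 v b1 b2; lia.
- move=> p0 i1 i2 v b1 b2; lia.
Qed.

(* Starting in state [U], as if a u step followed the path, counts the end of the
   path as one more valley and forbids a final v. *)
Lemma is_uvd_acc n t s : (0 < n)%N ->
  is_uvd n s && (vox s == t) = uvd_acc U 0 n t.+1 (rev s).
Proof.
move=> n0; rewrite uvd_acc_rev /is_uvd -/(stays_nonneg s).
rewrite [X in X == ((2 * n)%N%:Z, _)]surjective_pairing xpair_eqE.
case/lastP: s => [|p x].
  by rewrite point_size big_nil /=; case: n n0.
rewrite !infix2_rcons vox_rcons -[[:: D]]/(rcons [::] D) suffix_rcons suffix0s size_rcons.
rewrite stays_nonneg_rcons !point_rcons_size.
have := @stays_nonneg_end p.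
case: x; rewrite /=; case: (point p (size p)) => a b /=;
  move: (stays_nonneg p) (infix _ _) (infix _ _) (vox _) => p0 i1 i2 v;
  rewrite -?[U == V]/false -?[U == U]/true; lia.
Qed.

Lemma card_count_is (T : finType) (T' : eqType) (f : T -> T') (A : {set T})
    (P : pred T') z :
  injective f -> (forall y, reflect (exists2 x, x \in A & f x = y) (P y)) ->
  count_is P z -> #|A|%:Z = z.
Proof.
move=> f_inj AP [L uL [mL <-]]; congr Posz.
rewrite cardE -(size_map f); apply: perm_size; apply: uniq_perm => //.
  by rewrite map_inj_uniq ?enum_uniq.
move=> y; rewrite mL; apply/mapP/AP => [[x xA ->]|[x xA <-]]; exists x => //.
  by rewrite -mem_enum.
by rewrite mem_enum.
Qed.

Lemma count_is_rev (T : eqType) (P : pred (seq T)) z :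
  count_is P z -> count_is (fun s => P (rev s)) z.
Proof.
case=> L uL [mL <-]; exists (map rev L); last split.
- by rewrite (map_inj_uniq (can_inj revK)).
- by move=> s; rewrite -[s in LHS]revK (mem_map (can_inj revK)) mL.
- by rewrite size_map.
Qed.

Lemma card_UVD n t : (0 < n)%N -> #|UVD n t|%:Z = wz n t.+1.*2 t.+1.
Proof.
move=> n0; rewrite -mul2n -[(2 * _)%N]addn0.
have C := @count_is_rev _ _ _ (@uvd_acc_count U 0 n t.+1 (fun h => h)).
apply: (card_count_is (f := @bseqval _ _)) C => [|s]; first exact: val_inj.
rewrite -is_uvd_acc //; apply: (iffP idP) => [Ps|[b bA <-]]; last by rewrite inE in bA.
have /andP[/is_uvd_size le_s _] := Ps.
by exists (Bseq le_s) => //; rewrite inE.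
Qed.

(** * Inversion sequences by rank *)

Lemma wz_large (i : nat) k t : (i < t)%N -> wz i k t = 0.
Proof. by move=> lt; rewrite /wz wc_small. Qed.

(** Each summation over a tail multiplies by $1/(1-W)$; [wz_T] is the matching recurrence in [s]. *)
Lemma nrank_ge_count n :
  (forall s, (nrank s n)%:Z = wz n.+1 s.+1.*2 s.+1) ->
  (forall s, (nrank_ge s n)%:Z = wz n.+1 s.+1.*2.+1 s.+1) /\
  (forall s, (nrank_sum s n)%:Z = wz n.+1 s.+1.*2.+2 s.+1).
Proof.
move=> HR.
(* Downward induction on [s] can start because no rank at level [n] exceeds [n]. *)
have down (P : nat -> Prop) : (forall s, (n < s)%N -> P s) ->
    (forall s, P s.+1 -> P s) -> forall s, P s.
  move=> P0 PS s; have [d] := ubnP (n.+1 - s); elim: d s => // d IH s lt.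
  by case: (ltnP n s) => [/P0 //|le]; apply: PS; apply: IH; lia.
have H1 s : (nrank_ge s n)%:Z = wz n.+1 s.+1.*2.+1 s.+1.
  elim/down: s => s => [lt|IH].
    by rewrite wz_large //; congr Posz; apply: stat0 => t k le; lia.
  by rewrite nrank_geE PoszD HR IH -wz_T.
split=> //; elim/down => s => [lt|IH].
  by rewrite wz_large //; congr Posz; apply: stat0 => t k le; lia.
by rewrite nrank_sumE PoszD H1 IH -wz_T.
Qed.

(** The induction is joint: ranks at the next level need the excesses at this one, whose successors
    in turn need the ranks at both levels. *)
Lemma nrank_nexc_count n :
  (forall s, (nrank s n)%:Z = wz n.+1 s.+1.*2 s.+1) /\
  (forall s, (nexc_gt s n)%:Z =
     wz n s.*2.+4.+1 s.+1 - wz (n%:Z - 1) s.*2.+3 s).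
Proof.
elim: n => [|n [HR HK]].
  split=> s; rewrite /nrank /nexc_gt /stat big_seq1; last by rewrite wz_large.
  case: s => [|s]; last by rewrite wz_large.
  by rewrite wz_z /wz /= subr0 /wc big_nat1 fuss0.
have [HS1 HS2] := nrank_ge_count HR.
have HR' s : (nrank s n.+1)%:Z = wz n.+2 s.+1.*2 s.+1.
  have E1 : n.+2%:Z - 1 = n.+1 by lia.
  have E2 : n.+2%:Z - 2 = n by lia.
  have E3 : n.+1%:Z - 1 = n by lia.
  have E4 : n.+1%:Z - 2 = n%:Z - 1 by lia.
  have Z1 := wz_z n.+2 s.*2.+2 s; have Z2 := wz_z n.+1 s.*2.+3 s.
  have T1 := wz_T n.+1 s.*2.+1 s; have T2 := wz_T n s.*2.+2 s.
  have T3 := wz_T n.+1 s.*2 s.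
  rewrite E1 E2 in Z1; rewrite E3 E4 in Z2.
  (* For [s = 0] this is the coefficient of $x^{n+1}$ in $W^0=1$, which is 0. *)
  have prev : (if s is s'.+1 then nrank s' n else 0)%N%:Z = wz n.+1 s.*2 s.
    by case: (s) => [|s']; [rewrite wz_00 | rewrite HR].
  rewrite nrankS !PoszD HS2 HK prev !doubleS; lia.
split=> // s; have [HS1' _] := nrank_ge_count HR'.
have := congr1 Posz (nexc_gtS s n); rewrite !PoszD HK HS1 HS1' !doubleS.
have Z1 := wz_z n.+2 s.*2.+4.+1 s.+1; have Z2 := wz_z n.+1 s.*2.+3 s.
have E1 : n.+2%:Z - 1 = n.+1 by lia.
have E2 : n.+2%:Z - 2 = n by lia.
have E3 : n.+1%:Z - 1 = n by lia.
have E4 : n.+1%:Z - 2 = n%:Z - 1 by lia.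
rewrite E1 E2 in Z1; rewrite E3 E4 in Z2; rewrite E3; lia.
Qed.

(** * Transfer from finite functions to lists *)

Lemma first_desc_ffun n (e : {ffun 'I_n.+1 -> 'I_n.+1}) :
  (fdes e = (first_desc [seq val (e i) | i <- enum 'I_n.+1]).+1)%N.
Proof.
congr S; rewrite /first_desc size_map size_enum_ord; apply: eq_in_find => i.
rewrite mem_iota add0n => /andP[_ lt_i].
have E j (lt : (j < n.+1)%N) : entry e j = (nth 0%N [seq val (e i) | i <- enum 'I_n.+1] j)%:Z.
  rewrite /entry insubT (nth_map (Ordinal lt)) ?size_enum_ord //.
  by congr (Posz (val (e _))); apply/val_inj; rewrite /= nth_enum_ord.
rewrite (E i) //; case: (leqP n.+1 i.+1) => [le|lt]; last by rewrite E.
by rewrite /entry insubF // ltnNge le.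
Qed.

Lemma mem_IS102 n t (e : {ffun 'I_n.+1 -> 'I_n.+1}) :
  e \in IS102 n.+1 t <->
  invseq102 n.+1 [seq val (e i) | i <- enum 'I_n.+1] /\
  lrank [seq val (e i) | i <- enum 'I_n.+1] = t.
Proof.
set l := map _ _.
have nthE (i : 'I_n.+1) : nth 0%N l i = e i.
  by rewrite (nth_map i) ?size_enum_ord // nth_ord_enum.
have sz : size l = n.+1 by rewrite size_map size_enum_ord.
have ok : reflect (invseq102 n.+1 l) (is_invseq e && avoids102 e).
  apply: (iffP andP) => [[/forallP inv /forallP av]|[_ inv av]]; split=> //.
  - by move=> i lt; rewrite -[i]/(val (Ordinal lt)) nthE; apply: inv.
  - move=> i j k ijk lt_k.
    have lt_j : (j < n.+1)%N by lia.
    have lt_i : (i < n.+1)%N by lia.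
    have /forallP/(_ (Ordinal lt_j))/forallP/(_ (Ordinal lt_k))/implyP := av (Ordinal lt_i).
    by rewrite -!nthE /= => /(_ ijk)/negP.
  - by apply/forallP => i; rewrite -nthE; apply: inv.
  - apply/forallP => i; apply/forallP => j; apply/forallP => k; apply/implyP => ijk.
    by apply/negP; rewrite -!nthE; apply: av.
rewrite inE andbA.
(* The maximum is the entry at the first descent, and the successor in [fdes] cancels the -1 in
   [rank]; the difference left is nonnegative, so truncation is harmless. *)
have rankE : invseq102 n.+1 l -> rank e = lrank l.
  move=> okl; have fd := first_desc_invseq okl; have [lt_p _ _] := fd.
  have /andP[le_m _] := peak_le okl.
  rewrite /rank first_desc_ffun -/l.
  have -> : maxe e = peak l.
    rewrite sz in lt_p; apply/eqP; rewrite eqn_leq; apply/andP; split.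
      by apply/bigmax_leqP => i _; rewrite -nthE; apply: invseq102_max okl fd _.
    rewrite /peak -[first_desc l]/(val (Ordinal lt_p)) nthE.
    exact: (@leq_bigmax _ (fun i => e i : nat)).
  rewrite /lrank; lia.
split=> [/andP[/ok okl]|[okl <-]]; last by rewrite rankE // eqxx andbT; apply/ok.
by rewrite rankE // => /eqP[].
Qed.

Lemma card_IS102 n t : (0 < n)%N -> #|IS102 n t|%:Z = wz n t.+1.*2 t.+1.
Proof.
case: n => // n _; rewrite -(nrank_nexc_count n).1.
pose f (e : {ffun 'I_n.+1 -> 'I_n.+1}) := [seq val (e i) | i <- enum 'I_n.+1].
apply: (@card_count_is _ _ f _ (fun l => (l \in gen n) && (lrank l == t))).
- move=> e e' /eq_in_map E; apply/ffunP => i; apply/val_inj.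
  by apply: E; rewrite mem_enum.
- move=> l; apply: (iffP andP) => [[/mem_gen ok /eqP rk]|[e /mem_IS102[ok rk] <-]].
    have [sz le_l _] := ok.
    pose e := [ffun i : 'I_n.+1 => inord (nth 0%N l i) : 'I_n.+1].
    have fe : f e = l.
      apply: (@eq_from_nth _ 0%N) => [|i]; rewrite size_map size_enum_ord // => lt_i.
      rewrite (nth_map ord0) ?size_enum_ord // ffunE nth_enum_ord //= inordK //.
      exact: leq_ltn_trans (le_l _ lt_i) _.
    by exists e => //; apply/mem_IS102; rewrite -/(f e) fe.
  by split; [apply/mem_gen | apply/eqP].
exists [seq l <- gen n | lrank l == t]; first by rewrite filter_uniq ?gen_uniq.
split=> [l|]; first by rewrite mem_filter andbC.
by rewrite size_filter /nrank /stat -sum1_count big_mkcond; congr Posz; apply: eq_bigr => l _; case: eqP.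
Qed.

(** Termwise, multiplying by [j], nonzero since [t < j], reduces the claim to [fuss_closed] at
    $m=j-t-1$. *)
Lemma wc_closed n t :
  (wc n t.+1.*2 t.+1)%:~R =
    \sum_(t.+1 <= j < n.+1)
      (-1) ^+ (n - j) * (t.+1%:R / j%:R)
        * 'C(3 * j - t - 2, j - t - 1)%:R * 'C(j, n - j)%:R :> rat.
Proof.
rewrite /wc rmorph_sum /= big_nat [RHS]big_nat; apply: eq_bigr => j /andP[lt_tj le_jn].
have -> : (3 * j - t - 2 = 3 * (j - t.+1) + t.*2.+1)%N by lia.
rewrite -subnDA addn1 -[X in _ / X%:R](subnK lt_tj).
have := congr1 (fun z : int => z%:~R : rat) (fuss_closed (j - t.+1) t).
rewrite !rmorphM /= => E.
have nz : (j - t.+1 + t.+1)%:R != 0 :> rat by rewrite pnatr_eq0; lia.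
rewrite /zc -ltnS le_jn rmorphM rmorphXn rmorphN1 /=.
apply: (mulfI nz); rewrite mulrCA E.
by field; rewrite nat1r -natrD.
Qed.

Unset Implicit Arguments.

Theorem theorem4p1 (n t : nat) (hn : (1 <= n)%N) (ht : (t <= n - 1)%N) :
  #|IS102 n t| = #|UVD n t| /\
  #|UVD n t|%:R =
    \sum_(t.+1 <= j < n.+1)
      (-1) ^+ (n - j) * (t.+1%:R / j%:R)
        * 'C(3 * j - t - 2, j - t - 1)%:R * 'C(j, n - j)%:R :> rat.
Proof.
have EU := @card_UVD n t hn; have EI := @card_IS102 n t hn.
split; first by apply/eqP; rewrite -eqz_nat EU EI.
by rewrite -wc_closed -[wc _ _ _]/(wz n _ _) -EU.
Qed.
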